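(* Let $G=(V,E)$ be an undirected graph with $n\ge2$ vertices, $m$ edges and no isolated vertices, $b\in(0,\tfrac12]$, $\gamma\in(0,1)$, $\epsilon=\tfrac1{130}$, and $T\ge 6\cdot129\cdot130\cdot\frac{\ln n}{\gamma}$. Let $(\alpha^{(t)},\beta^{(t)})_{t=1}^T$, with $\alpha^{(t)}\in\mathbb R$ and $\beta^{(t)}\in\mathbb R^V_{\ge0}$, be such that, setting $P^{(t)}=\frac16\big(M(\alpha^{(t)},\beta^{(t)})+\gamma L(K_V)\big)$ and $X^{(t)}=U_\epsilon\big(\sum_{i=1}^{t-1}P^{(i)}\big)$ (so $X^{(1)}=U_\epsilon(0)$), for every $t\in[T]$: $V(\alpha^{(t)},\beta^{(t)})\ge\tfrac34\gamma$, $M(\alpha^{(t)},\beta^{(t)})\bullet X^{(t)}\ge\tfrac1{64}\gamma$, and $-\gamma L(K_V)\preceq M(\alpha^{(t)},\beta^{(t)})\preceq 3L(K_V)$. Then $\bar\alpha=\frac1T\sum_t\alpha^{(t)}$ and $\bar\beta=\frac1T\sum_t\beta^{(t)}$ satisfy $M(\bar\alpha,\bar\beta)\succeq0$ and $V(\bar\alpha,\bar\beta)\ge\tfrac34\gamma$.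
   Context: $d_i$ is the degree of $i$, $D=\mathrm{diag}(d)$, $\mu_i=d_i/(2m)$, $L=D-A$ is the Laplacian of $G$. $L(K_V)=\mathrm{diag}(\mu)-\mu\mu^T$ (Laplacian of the complete graph with pair weights $\mu_i\mu_j$). For $i\in V$, $R_i=(e_i-\mu)(e_i-\mu)^T$, so that for the Gram matrix $X$ of vectors $\{v_j\}$, $R_i\bullet X=\|v_i-\sum_j\mu_jv_j\|_2^2$. $A\bullet B=\mathrm{Tr}(A^TB)$. Define $V(\alpha,\beta)=\alpha-\frac{1-b}{b}\sum_{i\in V}\beta_i$ and $M(\alpha,\beta)=\frac1{2m}L+\sum_{i\in V}\beta_iR_i-\alpha L(K_V)$. $\mathcal I=I-\frac1{2m}D^{1/2}\mathbf 1\mathbf 1^TD^{1/2}$ and for symmetric $M$, $U_\epsilon(M)=2m\cdot\dfrac{D^{-1/2}\exp(-(2m\epsilon)D^{-1/2}MD^{-1/2})D^{-1/2}}{\mathcal I\bullet\exp(-(2m\epsilon)D^{-1/2}MD^{-1/2})}$. *)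

(* Defs.v *)
(* real numbers from Stdlib Reals.
   Vertices are the naturals 0 .. n-1; matrices are functions nat -> nat -> R
   of which only the entries with indices < n are meaningful. *)
From Stdlib Require Import Arith Factorial Reals ClassicalEpsilon.
Open Scope R_scope.

Definition Mat := nat -> nat -> R.

Fixpoint fsum (k : nat) (f : nat -> R) : R :=
  match k with O => 0 | S k' => fsum k' f + f k' end.

(* sum_{t = a}^{b} f t  (empty if b < a) *)
Definition fsum_range (a b : nat) (f : nat -> R) : R :=
  fsum (S b - a) (fun s => f (a + s)%nat).

Definition kron (i j : nat) : R := if Nat.eqb i j then 1 else 0.

Definition madd (A B : Mat) : Mat := fun i j => A i j + B i j.
Definition mscale (c : R) (A : Mat) : Mat := fun i j => c * A i j.
Definition mzero : Mat := fun _ _ => 0.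
Definition mid : Mat := fun i j => kron i j.
Definition mmul (n : nat) (A B : Mat) : Mat :=
  fun i j => fsum n (fun k => A i k * B k j).
Fixpoint mpow (n : nat) (A : Mat) (k : nat) : Mat :=
  match k with O => mid | S k' => mmul n (mpow n A k') A end.
Definition msum_range (a b : nat) (F : nat -> Mat) : Mat :=
  fun i j => fsum_range a b (fun t => F t i j).

Definition mdot (n : nat) (A B : Mat) : R :=
  fsum n (fun i => fsum n (fun j => A i j * B i j)).

Definition psd (n : nat) (A : Mat) : Prop :=
  forall x : nat -> R, 0 <= fsum n (fun i => fsum n (fun j => x i * A i j * x j)).
Definition loewner_le (n : nat) (A B : Mat) : Prop :=
  psd n (madd B (mscale (-1) A)).

Definition mexp_partial (n : nat) (A : Mat) (K : nat) : Mat :=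
  fun i j => sum_f_R0 (fun k => mpow n A k i j / INR (fact k)) K.
Definition is_mexp (n : nat) (A E : Mat) : Prop :=
  forall i j, (i < n)%nat -> (j < n)%nat ->
    Un_cv (fun K => mexp_partial n A K i j) (E i j).
Definition mexp (n : nat) (A : Mat) : Mat :=
  epsilon (inhabits mzero) (fun E => is_mexp n A E).

Definition simple_graph (n : nat) (adj : nat -> nat -> bool) : Prop :=
  (forall i j, (i < n)%nat -> (j < n)%nat -> adj i j = adj j i) /\
  (forall i, (i < n)%nat -> adj i i = false).

Definition no_isolated (n : nat) (adj : nat -> nat -> bool) : Prop :=
  forall i, (i < n)%nat -> exists j, (j < n)%nat /\ adj i j = true.

Definition adjm (adj : nat -> nat -> bool) : Mat :=
  fun i j => if adj i j then 1 else 0.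

Definition deg (n : nat) (adj : nat -> nat -> bool) (i : nat) : R :=
  fsum n (fun j => adjm adj i j).

Definition twom (n : nat) (adj : nat -> nat -> bool) : R :=
  fsum n (deg n adj).

Definition mu (n : nat) (adj : nat -> nat -> bool) (i : nat) : R :=
  deg n adj i / twom n adj.

Definition lap (n : nat) (adj : nat -> nat -> bool) : Mat :=
  fun i j => kron i j * deg n adj i - adjm adj i j.

Definition lapK (n : nat) (adj : nat -> nat -> bool) : Mat :=
  fun i j => kron i j * mu n adj i - mu n adj i * mu n adj j.

Definition Rmat (n : nat) (adj : nat -> nat -> bool) (i : nat) : Mat :=
  fun k l => (kron k i - mu n adj k) * (kron l i - mu n adj l).

Definition Mab (n : nat) (adj : nat -> nat -> bool) (alpha : R) (beta : nat -> R) : Mat :=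
  fun k l => / twom n adj * lap n adj k l
             + fsum n (fun i => beta i * Rmat n adj i k l)
             - alpha * lapK n adj k l.

Definition Vab (n : nat) (b alpha : R) (beta : nat -> R) : R :=
  alpha - (1 - b) / b * fsum n beta.

Definition Ihat (n : nat) (adj : nat -> nat -> bool) : Mat :=
  fun i j => kron i j - / twom n adj * (sqrt (deg n adj i) * sqrt (deg n adj j)).

Definition dhalf_conj (n : nat) (adj : nat -> nat -> bool) (A : Mat) : Mat :=
  fun i j => / sqrt (deg n adj i) * A i j * / sqrt (deg n adj j).

Definition Ueps (n : nat) (adj : nat -> nat -> bool) (eps : R) (M : Mat) : Mat :=
  let E := mexp n (mscale (- (twom n adj * eps)) (dhalf_conj n adj M)) in
  mscale (twom n adj / mdot n (Ihat n adj) E) (dhalf_conj n adj E).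

(* Main.v *)
(* Conjugating by D^{1/2} turns L(K_V) into (1/2m) times the projector orthogonal
   to u = D^{1/2} 1 / sqrt(2m) and the step matrices P^(t) into symmetric N_t that kill
   u and satisfy 0 <= N_t <= 2/3.  With S_t = N_1 + ... + N_{t-1}, the potential
   Phi_t = tr exp(- eps S_t) - 1 is the normalisation of X^(t), and the hypothesis on
   M . X^(t) bounds tr (N_t exp(- eps S_t)) below by (65/384) gamma Phi_t.

   Phi decreases geometrically by the trace inequality
     tr exp(A - B) <= tr exp A - (1 - 3 eta / 2) tr (B exp A)      (0 <= B <= eta),
   which replaces the Golden-Thompson inequality: if a_p and c_q are the eigenvalues of
   A and C = A - B and w_pq the squared scalar products of their eigenvectors, then
   tr (f(A) g(C)) = sum_pq w_pq f(a_p) g(c_q), and scalar inequalities in a_p, c_q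
   can be integrated against w.

   Finally Phi_{T+1} >= exp (- eps x S x^T) for each unit x orthogonal to u (Jensen and
   Bessel), so S is large on the complement of u, and it is 6^{-1} T (M + gamma L(K_V))
   at the averages, up to the conjugation. *)
Require Import Defs.
From Stdlib Require Import Reals.

(* The MathComp notations on nat and on the reals stay inside this module, so that
   the final statement is read with the Stdlib ones. *)
Module MatrixWeights.
From HB Require Import structures.
From Stdlib Require Import ClassicalEpsilon.
From mathcomp Require Import all_boot all_order all_algebra.
From mathcomp Require Import spectral complex ring lra Rstruct.
Set Implicit Arguments.
Unset Strict Implicit.
Unset Printing Implicit Defensive.
Import Order.TTheory GRing.Theory Num.Theory.
Local Open Scope ring_scope.

(** * Real spectral theorem *)

(** Over the complex closure the matrix is hermitian, so its spectral diagonal is real. An entry of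
    that diagonal is a root of the characteristic polynomial, which has coefficients in [R], so it
    is already an eigenvalue over [R]. *)
Lemma symmetric_real_eigenvalue (R : rcfType) n (A : 'M[R]_n.+1) :
  A^T = A -> exists l, eigenvalue A l.
Proof.
move=> symA; pose f := real_complex R; pose AC := map_mx f A.
have realA : AC \is a mxOver Num.real.
  by apply/mxOverP => i j; rewrite mxE complex_real.
have hermA : AC \is hermsymmx.
  apply: realsym_hermsym => //.
  by apply/is_hermitianmxP; rewrite expr0 scale1r map_mx_id ?/AC ?map_trmx ?symA.
have /orthomx_spectralP specA := hermitian_normalmx hermA.
have /mxOverP/(_ 0 0)/complex_realP[l dl] := hermitian_spectral_diag_real hermA.
exists l; rewrite eigenvalue_root_char -(fmorph_root (real_complex R)).
rewrite map_char_poly -eigenvalue_root_char -/AC.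
have unitP := spectral_unit AC.
set P := spectralmx AC in specA unitP.
apply/eigenvalueP; exists (row 0 P); last first.
  apply: contraTneq unitP => P0; rewrite unitmxE (expand_det_row _ 0).
  rewrite big1 ?unitr0 // => j _.
  by have /matrixP/(_ 0 j) := P0; rewrite !mxE => ->; rewrite mul0r.
rewrite -row_mul {1}specA !mulmxA mulmxV // mul1mx.
apply/rowP => j; rewrite !mxE (bigD1 0) //= big1 ?addr0 => [|k /negPf k0].
  by rewrite !mxE eqxx mulr1n dl.
by rewrite !mxE eq_sym k0 mulr0n mul0r.
Qed.

Definition sqn (R : rcfType) n (x : 'rV[R]_n) : R := (x *m x^T) 0 0.

Lemma sqnE (R : rcfType) n (x : 'rV[R]_n) : sqn x = \sum_i x 0 i ^+ 2.
Proof. by rewrite /sqn mxE; apply: eq_bigr => i _; rewrite mxE. Qed.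

Lemma sqn_ge0 (R : rcfType) n (x : 'rV[R]_n) : 0 <= sqn x.
Proof. by rewrite sqnE; apply: sumr_ge0 => i _; exact: sqr_ge0. Qed.

Lemma sqn_eq0 (R : rcfType) n (x : 'rV[R]_n) : (sqn x == 0) = (x == 0).
Proof.
rewrite sqnE psumr_eq0; last by move=> i _; exact: sqr_ge0.
apply/allP/eqP => [x0|-> i _]; last by rewrite mxE expr0n /=.
by apply/rowP => i; have := x0 i (mem_index_enum i); rewrite sqrf_eq0 mxE => /eqP.
Qed.

(** The reflection in the hyperplane orthogonal to [w = v - e_0] exchanges the unit vectors [v] and
    [e_0]; the identity serves when [w = 0]. *)
Lemma householder (R : rcfType) n (v : 'rV[R]_n.+1) : sqn v = 1 ->
  exists H : 'M[R]_n.+1, [/\ H^T = H, H *m H = 1%:M & v *m H = delta_mx 0 0].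
Proof.
move=> v1; have [w def_w] : exists w, w = v - delta_mx 0 0 by eexists.
have [w0|w0] := eqVneq w 0.
  exists 1%:M; rewrite trmx1 !mulmx1; split => //.
  by apply/eqP; rewrite -subr_eq0 -def_w w0.
have s0 : sqn w != 0 by rewrite sqn_eq0.
have wwT : w *m w^T = (sqn w)%:M by rewrite [LHS]mx11_scalar.
(* Both [v] and [e_0] are unit vectors, so the squared norm of [w] is [2 (1 - v_0)], twice the
   scalar product of [v] and [w]. *)
have vwT : v *m w^T = (sqn w / 2)%:M.
  rewrite [LHS]mx11_scalar; congr (_%:M).
  have vv : v *m v^T = 1%:M by rewrite [LHS]mx11_scalar -/(sqn v) v1.
  have ee : (delta_mx 0 0 : 'rV[R]_n.+1) *m (delta_mx 0 0)^T = 1%:M.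
    rewrite trmx_delta mul_delta_mx; apply/matrixP => i j.
    by rewrite !mxE !ord1.
  have ev : delta_mx 0 0 *m v^T = v *m (delta_mx 0 0)^T.
    apply/matrixP => i j; rewrite !ord1 !mxE; apply: eq_bigr => k _.
    by rewrite !mxE mulrC.
  rewrite /sqn def_w !linearB /= !mulmxBl ee vv ev !mxE /=; by field.
exists (1%:M - (2 / sqn w) *: (w^T *m w)).
set c := 2 / sqn w; split.
- by rewrite linearB /= linearZ /= trmx_mul trmxK trmx1.
- have q : (w^T *m w) *m (w^T *m w) = sqn w *: (w^T *m w).
    by rewrite mulmxA -(mulmxA w^T) wwT mul_mx_scalar -scalemxAl.
  rewrite mulmxBl mul1mx mulmxBr mulmx1 -scalemxAl -scalemxAr q.
  rewrite opprB -addrA; apply/matrixP => i j; rewrite !mxE /c; field.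
  exact: s0.
- rewrite mulmxBr mulmx1 -scalemxAr mulmxA vwT mul_scalar_mx scalerA /c.
  rewrite mulrA divfK // divff ?pnatr_eq0 // scale1r def_w.
  by rewrite opprB addrC subrK.
Qed.

(** Deflation: a Householder reflection moves a unit eigenvector to [e_0], symmetry then clears the
    first row and column, and the induction hypothesis diagonalises the remaining block. *)
Theorem real_spectral (R : rcfType) n (A : 'M[R]_n) : A^T = A ->
  exists (U : 'M[R]_n) (d : 'rV[R]_n),
    U *m U^T = 1%:M /\ A = U^T *m diag_mx d *m U.
Proof.
elim: n A => [|n IHn] A symA.
  by exists 1%:M, 0; split; apply/matrixP => -[].
have [l /eigenvalueP[v0 Av0 v0n0]] := symmetric_real_eigenvalue symA.
have s0 : 0 < sqn v0 by rewrite lt_neqAle sqn_ge0 andbT eq_sym sqn_eq0.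
pose v := (Num.sqrt (sqn v0))^-1 *: v0.
have v1 : sqn v = 1.
  rewrite /sqn linearZ /= -scalemxAl -scalemxAr 2!mxE -/(sqn v0) mulrA -invfM.
  by rewrite -expr2 sqr_sqrtr ?ltW // mulVf ?gt_eqF.
have Av : v *m A = l *: v by rewrite -scalemxAl Av0 !scalerA mulrC.
have [H [symH HH vH]] := householder v1.
pose A' := H *m A *m H.
have defA : A = H *m A' *m H by rewrite !mulmxA HH mul1mx -mulmxA HH mulmx1.
have symA' : A'^T = A' by rewrite !trmx_mul symH symA mulmxA.
have eA' : delta_mx 0 0 *m A' = l *: (delta_mx 0 0 : 'rV_n.+1).
  by rewrite -vH !mulmxA -(mulmxA v) HH mulmx1 Av -!scalemxAl.
clearbody A'.
have A'0j j : A' 0 j = l * (j == 0)%:R.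
  by have /rowP/(_ j) := eA'; rewrite -rowE !mxE eqxx /= => ->.
pose B : 'M[R]_n := drsubmx (A' : 'M_(1 + n)).
have symB : B^T = B by rewrite /B trmx_drsub symA'.
have blkA' : A' = block_mx l%:M 0 0 B :> 'M_(1 + n).
  rewrite -[LHS](@submxK _ 1 n 1 n); congr block_mx.
  - by apply/matrixP => i j; rewrite !ord1 !mxE lshift0 A'0j mulr1.
  - apply/matrixP => i j; rewrite !ord1 !mxE lshift0 A'0j.
    by rewrite -val_eqE /= mulr0.
  - apply/matrixP => i j; rewrite !ord1 !mxE lshift0 -symA' mxE A'0j.
    by rewrite -val_eqE /= mulr0.
have [U [d [UU defB]]] := IHn B symB.
pose W : 'M[R]_(1 + n) := block_mx 1%:M 0 0 U.
have trW : W^T = block_mx 1%:M 0 0 U^T by rewrite tr_block_mx !trmx0 trmx1.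
exists (W *m H), (row_mx l%:M d : 'rV_(1 + n)); split.
  rewrite trmx_mul symH mulmxA -(mulmxA W) HH mulmx1.
  suff WW : W *m W^T = 1%:M :> 'M_(1 + n) by exact: WW.
  rewrite trW mulmx_block !mulmx0 !mul0mx !addr0 !add0r mulmx1 UU.
  by rewrite -scalar_mx_block.
rewrite defA trmx_mul symH !mulmxA; congr (_ *m H); rewrite -!mulmxA; congr (H *m _).
suff defA' : A' = W^T *m (diag_mx (row_mx l%:M d) *m W) :> 'M_(1 + n).
  exact: defA'.
rewrite trW diag_mx_row !mulmx_block !mulmx0 !mul0mx !addr0 !add0r !mul1mx.
rewrite !mulmx1 blkA' mulmxA -defB; congr block_mx => //.
- by apply/matrixP => i j; rewrite !ord1 !mxE.
- by rewrite mulmx0.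
Qed.

(** * Trace inequalities for exponentials of symmetric matrices *)

Definition quad (R : rcfType) n (M : 'M[R]_n) (x : 'rV[R]_n) : R :=
  (x *m M *m x^T) 0 0.

Definition psdm (R : rcfType) n (M : 'M[R]_n) := forall x, 0 <= quad M x.

Section Quad.
Variables (R : rcfType) (n : nat).
Implicit Types (M N : 'M[R]_n) (x : 'rV[R]_n).

Lemma quadD M N x : quad (M + N) x = quad M x + quad N x.
Proof. by rewrite /quad mulmxDr mulmxDl mxE. Qed.

Lemma quadB M N x : quad (M - N) x = quad M x - quad N x.
Proof. by rewrite /quad mulmxBr mulmxBl mxE [X in _ + X]mxE. Qed.

Lemma quadZ k M x : quad (k *: M) x = k * quad M x.
Proof. by rewrite /quad -scalemxAr -scalemxAl mxE. Qed.

Lemma quad_scalar k x : quad k%:M x = k * sqn x.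
Proof. by rewrite /quad mul_mx_scalar -scalemxAl mxE. Qed.
End Quad.

(** Functional calculus on a chosen diagonalisation: the rows of [U] are eigenvectors and [a] lists
    the eigenvalues. Keeping [U] and [a] explicit avoids proving independence of the choice. *)
Definition specf (R : rcfType) n (U : 'M[R]_n) (a : 'rV[R]_n) (f : R -> R) :=
  U^T *m diag_mx (map_mx f a) *m U.

Section Specf.
Variables (R : rcfType) (n : nat).
Implicit Types (U W : 'M[R]_n) (a c : 'rV[R]_n) (f g : R -> R).

Lemma eq_specf U a f g : f =1 g -> specf U a f = specf U a g.
Proof.
by move=> fg; congr (_ *m diag_mx _ *m _); apply/rowP => i; rewrite !mxE fg.
Qed.

Lemma specf1 U a : U *m U^T = 1%:M -> specf U a (fun=> 1) = 1%:M.
Proof.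
move=> UU; rewrite /specf.
have -> : diag_mx (map_mx (fun=> 1 : R) a) = 1%:M.
  by rewrite -diag_const_mx; congr diag_mx; apply/rowP => i; rewrite !mxE.
by rewrite mulmx1 (mulmx1C UU).
Qed.

Lemma specfM U a f g : U *m U^T = 1%:M ->
  specf U a f *m specf U a g = specf U a (fun x => f x * g x).
Proof.
move=> UU; rewrite /specf !mulmxA; congr (_ *m _); rewrite -!mulmxA.
congr (_ *m _); rewrite (mulmxA U) UU mul1mx mulmx_diag.
by congr diag_mx; apply/rowP => i; rewrite !mxE.
Qed.

Lemma trace_specf U W a c f g :
  \tr (specf U a f *m specf W c g) =
  \sum_p \sum_q f (a 0 p) * g (c 0 q) * (U *m W^T) p q ^+ 2.
Proof.
rewrite /specf -!mulmxA mxtrace_mulC -!mulmxA.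
set V := U *m W^T; have -> : W *m U^T = V^T by rewrite trmx_mul trmxK.
rewrite (mulmxA U) -/V; apply: eq_bigr => p _; rewrite mul_diag_mx !mxE mulr_sumr.
apply: eq_bigr => q _; rewrite mul_diag_mx !mxE; ring.
Qed.

Lemma quad_specf U a f x :
  quad (specf U a f) x = \sum_p f (a 0 p) * (x *m U^T) 0 p ^+ 2.
Proof.
rewrite /quad /specf !mulmxA -mulmxA -[U in U *m x^T]trmxK -trmx_mul mxE.
by apply: eq_bigr => p _; rewrite mul_mx_diag !mxE; ring.
Qed.

Lemma sqn_orth U x : U *m U^T = 1%:M -> sqn (x *m U^T) = sqn x.
Proof.
by move=> UU; rewrite /sqn trmx_mul trmxK -mulmxA (mulmxA U^T) (mulmx1C UU) mul1mx.
Qed.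

Lemma quad_row_specf U a f p : U *m U^T = 1%:M ->
  quad (specf U a f) (row p U) = f (a 0 p).
Proof.
move=> UU; rewrite quad_specf -row_mul UU (bigD1 p) //= big1 => [|q /negPf pq].
  by rewrite !mxE eqxx expr1n mulr1 addr0.
by rewrite !mxE eq_sym pq expr0n mulr0.
Qed.

Lemma sqn_row_orth U p : U *m U^T = 1%:M -> sqn (row p U) = 1.
Proof.
move=> UU; transitivity ((U *m U^T) p p); last by rewrite UU mxE eqxx.
by rewrite /sqn !mxE; apply: eq_bigr => k _; rewrite !mxE.
Qed.

(** A factor [1] is inserted as the constant function of the other matrix, which turns the
    single-matrix term into a double sum over the same weights. *)
Lemma trace_mulDspecf U W a c f g h : U *m U^T = 1%:M -> W *m W^T = 1%:M ->
  \tr ((specf U a f - specf W c g) *m specf U a h) =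
  \sum_p \sum_q (f (a 0 p) - g (c 0 q)) * h (a 0 p) * (U *m W^T) p q ^+ 2.
Proof.
move=> UU WW; rewrite mulmxBl linearB /= specfM //.
rewrite -[specf U a _ in X in X - _]mulmx1 -(specf1 c WW) (mxtrace_mulC (specf W c g)).
rewrite !trace_specf -sumrB; apply: eq_bigr => p _.
by rewrite -sumrB; apply: eq_bigr => q _; ring.
Qed.

Lemma trace_sqrDspecf U W a c f g h : U *m U^T = 1%:M -> W *m W^T = 1%:M ->
  \tr ((specf U a f - specf W c g) *m (specf U a f - specf W c g) *m specf U a h) =
  \sum_p \sum_q (f (a 0 p) - g (c 0 q)) ^+ 2 * h (a 0 p) * (U *m W^T) p q ^+ 2.
Proof.
move=> UU WW; set A := specf U a f; set C := specf W c g; set H := specf U a h.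
(* [A] and [C] need not commute, but cyclicity of the trace makes the factors [C] adjacent in each
   term, so each term has the form tr (f(A) g(C)). *)
have -> : \tr ((A - C) *m (A - C) *m H) =
    \tr (A *m (A *m H) *m 1%:M) - \tr (A *m H *m C) - \tr (H *m A *m C)
    + \tr (H *m (C *m C)).
  have E1 : \tr (A *m C *m H) = \tr (H *m A *m C) by rewrite mxtrace_mulC mulmxA.
  have E2 : \tr (C *m A *m H) = \tr (A *m H *m C) by rewrite -mulmxA mxtrace_mulC.
  have E3 : \tr (C *m C *m H) = \tr (H *m (C *m C)) by rewrite mxtrace_mulC.
  rewrite mulmx1 mulmxBr !mulmxBl !linearB /= E1 E2 E3 (mulmxA A A H); ring.
rewrite -(specf1 c WW) !specfM // !trace_specf -!sumrB -big_split /=.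
apply: eq_bigr => p _; rewrite -!sumrB -big_split /=.
by apply: eq_bigr => q _; ring.
Qed.
End Specf.

(** * Scalar inequalities for the exponential and the trace inequality drawn from them *)

Local Notation R := Rdefinitions.R.
Local Notation exp := Rtrigo_def.exp.
Local Arguments Rtrigo_def.exp x%_ring_scope.

Lemma exp_addr (x y : R) : exp (x + y) = exp x * exp y.
Proof. by rewrite expRD. Qed.

Lemma exp_gt0 (x : R) : 0 < exp x.
Proof. exact/RltP/Exp_prop.exp_pos. Qed.

Lemma exp_ge1Dx (x : R) : 1 + x <= exp x.
Proof. exact/RleP/Rpower.exp_ineq1_le. Qed.

(* Otherwise arguments of type R would be read in R_scope. *)
Arguments exp_addr : clear scopes.
Arguments exp_gt0 : clear scopes.
Arguments exp_ge1Dx : clear scopes.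

(* Halving the argument turns the elementary bound [e^y - 1 <= y e^y] into a
   second order estimate without any calculus. *)
Lemma exp_remainder_le (x : R) :
  exp x - 1 - x <= 3 / 4 * x ^+ 2 * (1 + exp x).
Proof.
have [y ->] : exists y, x = y + y by exists (x / 2); field.
rewrite exp_addr.
have e0 := exp_gt0 y; have e1 := exp_ge1Dx y.
have e2 : (1 - y) * exp y <= 1.
  by have := exp_addr (- y) y; rewrite addNr expR0; have := exp_ge1Dx (- y); nra.
set e := exp y in e0 e1 e2 *.
have [y0|y0] := leP 0 y.
  have : (e - 1) ^+ 2 <= (y * e) ^+ 2 by rewrite lerXn2r ?nnegrE; nra.
  have : e - 1 - y <= y * (y * e) by nra.
  nra.
have : (e - 1) ^+ 2 <= y ^+ 2 by nra.
have : e - 1 - y <= y ^+ 2 by nra.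
nra.
Qed.

Arguments exp_remainder_le : clear scopes.

(** This is [exp_remainder_le] at [c - a], scaled by [exp a]. Integrated against the weights, the
    right side becomes traces of [B^2 exp A] and [B^2 exp C]. *)
Lemma exp_chord_le (a c : R) :
  exp c - exp a + (a - c) * exp a <= 3 / 4 * (a - c) ^+ 2 * (exp a + exp c).
Proof.
have -> : exp c = exp a * exp (c - a) by rewrite -exp_addr addrC subrK.
have := exp_remainder_le (c - a); have := exp_gt0 a; nra.
Qed.

(** Monotonicity of [exp] in product form; integrated, it gives tr (B exp C) <= tr (B exp A). *)
Lemma exp_mono_mul (a c : R) : (a - c) * exp c <= (a - c) * exp a.
Proof.
have -> : exp a = exp c * exp (a - c) by rewrite -exp_addr addrC subrK.
have yE : 0 <= (a - c) * (exp (a - c) - 1).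
  have e1 := exp_ge1Dx (a - c); have e2 := exp_ge1Dx (- (a - c)).
  have e3 : exp (- (a - c)) * exp (a - c) = 1 by rewrite -exp_addr addNr expR0.
  have e4 := exp_gt0 (a - c); set y := a - c in e1 e2 e3 e4 *.
  have [y0|y0] := leP 0 y; first by apply: mulr_ge0; lra.
  suff : exp y <= 1 by move=> ?; apply: mulr_le0; lra.
  nra.
by have := exp_gt0 c; nra.
Qed.

(** In the eigenbases of [B] and of the other matrix this reduces to [b^2 <= eta b] for the
    eigenvalues [b] of [B], which lie between [0] and [eta]. *)
Lemma trace_sqr_le n (B U : 'M[R]_n) (a : 'rV[R]_n) f eta :
  B^T = B -> psdm B -> psdm (eta%:M - B) -> U *m U^T = 1%:M ->
  (forall x : R, 0 <= f x) ->
  \tr (B *m B *m specf U a f) <= eta * \tr (B *m specf U a f).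
Proof.
move=> symB B0 Beta UU f0.
have [Z [b [ZZ defB]]] := real_spectral symB.
have {}defB : B = specf Z b id by rewrite /specf map_mx_id.
have bE p : b 0 p = quad B (row p Z) by rewrite defB quad_row_specf.
have b0 p : 0 <= b 0 p by rewrite bE.
have beta p : b 0 p <= eta.
  by have := Beta (row p Z); rewrite quadB quad_scalar sqn_row_orth // bE; lra.
rewrite defB specfM // !trace_specf mulr_sumr; apply: ler_sum => p _.
rewrite mulr_sumr; apply: ler_sum => q _ /=.
rewrite [leRHS]mulrA; apply: ler_wpM2r; first exact: sqr_ge0.
by rewrite mulrA; apply: ler_wpM2r => //; apply: ler_wpM2r.
Qed.

Theorem trace_exp_sub_le n (U W : 'M[R]_n) (a c : 'rV[R]_n) (eta : R) :
  U *m U^T = 1%:M -> W *m W^T = 1%:M ->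
  let B := specf U a id - specf W c id in
  psdm B -> psdm (eta%:M - B) -> 0 <= eta ->
  \tr (specf W c exp) <=
    \tr (specf U a exp) - (1 - 3 / 2 * eta) * \tr (B *m specf U a exp).
Proof.
move=> UU WW B B0 Beta eta0.
have symS V d : (specf V d id)^T = specf V d id :> 'M[R]_n.
  by rewrite /specf !trmx_mul trmxK tr_diag_mx mulmxA.
have symB : B^T = B by rewrite /B linearB /= !symS.
have exp0 (x : R) : 0 <= exp x by apply/ltW/exp_gt0.
have hA : \tr (B *m B *m specf U a exp) <= eta * \tr (B *m specf U a exp).
  exact: trace_sqr_le.
have hC : \tr (B *m B *m specf W c exp) <= eta * \tr (B *m specf W c exp).
  exact: trace_sqr_le.
pose w p q := (U *m W^T) p q ^+ 2.
(* [S] integrates a function of an eigenvalue pair against the weights; each trace below is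
   rewritten as such an integral. *)
pose S (F : R -> R -> R) := \sum_p \sum_q F (a 0 p) (c 0 q) * w p q.
have S_le F G : (forall x y, F x y <= G x y) -> S F <= S G.
  move=> FG; apply: ler_sum => p _; apply: ler_sum => q _.
  by rewrite ler_wpM2r ?sqr_ge0.
have S_sym F : \sum_p \sum_q F (c 0 p) (a 0 q) * (W *m U^T) p q ^+ 2 =
    S (fun x y => F y x).
  rewrite exchange_big; apply: eq_bigr => p _; apply: eq_bigr => q _.
  by rewrite /w -[U *m W^T]trmxK trmx_mul trmxK [(_^T) p q]mxE.
have SD F G : S (fun x y => F x y + G x y) = S F + S G.
  rewrite -big_split; apply: eq_bigr => p _; rewrite -big_split.
  by apply: eq_bigr => q _; rewrite mulrDl.
have SZ k F : S (fun x y => k * F x y) = k * S F.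
  rewrite mulr_sumr; apply: eq_bigr => p _; rewrite mulr_sumr.
  by apply: eq_bigr => q _; rewrite mulrA.
have trA : \tr (specf U a exp) = S (fun x y => exp x).
  rewrite -[specf _ _ _]mulmx1 -(specf1 c WW) trace_specf.
  by apply: eq_bigr => p _; apply: eq_bigr => q _; rewrite mulr1.
have trC : \tr (specf W c exp) = S (fun x y => exp y).
  rewrite -[specf _ _ _]mul1mx -(specf1 a UU) trace_specf.
  by apply: eq_bigr => p _; apply: eq_bigr => q _; rewrite mul1r.
have trBA : \tr (B *m specf U a exp) = S (fun x y => (x - y) * exp x).
  by rewrite trace_mulDspecf.
have trBC : \tr (B *m specf W c exp) = S (fun x y => (x - y) * exp y).
  rewrite -[B]opprK opprB mulNmx linearN /= trace_mulDspecf //.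
  rewrite (S_sym (fun x y => (x - y) * exp x)).
  by rewrite -mulN1r -SZ; apply: eq_bigr => p _; apply: eq_bigr => q _; ring.
have trBBA : \tr (B *m B *m specf U a exp) = S (fun x y => (x - y) ^+ 2 * exp x).
  by rewrite trace_sqrDspecf.
have trBBC : \tr (B *m B *m specf W c exp) = S (fun x y => (x - y) ^+ 2 * exp y).
  have -> : B *m B = (- B) *m (- B) by rewrite mulmxN mulNmx opprK.
  rewrite /B opprB trace_sqrDspecf //.
  rewrite (S_sym (fun x y => (x - y) ^+ 2 * exp x)).
  by apply: eq_bigr => p _; apply: eq_bigr => q _; ring.
(* With [h1], tr exp C <= tr exp A - tr (B exp A) + 3/4 (tr (B^2 exp A) + tr (B^2 exp C)). By [hA]
   and [hC] the bracket is at most [eta] (tr (B exp A) + tr (B exp C)), and [h2] bounds the last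
   trace by the one before it. *)
have h1 : S (fun x y => exp y) <= S (fun x y => exp x + (-1) * ((x - y) * exp x)
    + 3 / 4 * ((x - y) ^+ 2 * exp x + (x - y) ^+ 2 * exp y)).
  by apply: S_le => x y; have := exp_chord_le x y; lra.
have h2 : S (fun x y => (x - y) * exp y) <= S (fun x y => (x - y) * exp x).
  by apply: S_le => x y; exact: exp_mono_mul.
rewrite !(SD, SZ) in h1.
rewrite trA trC trBA; rewrite trBA trBBA in hA; rewrite trBC trBBC in hC.
nra.
Qed.

(** The projection of [e_p] on the span of [x] and [u] has squared norm [s] and [p]-th coordinate
    [s]. Hence [s^2 <= s]. *)
Lemma bessel_entry (R : rcfType) n (x u : 'rV[R]_n) p :
  sqn x = 1 -> sqn u = 1 -> x *m u^T = 0 -> x 0 p ^+ 2 + u 0 p ^+ 2 <= 1.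
Proof.
rewrite !sqnE => x1 u1 /matrixP/(_ 0 0); rewrite !mxE => xu.
pose s := x 0 p ^+ 2 + u 0 p ^+ 2.
have : s ^+ 2 <= s; last first.
  rewrite -/s; have : 0 <= s by rewrite addr_ge0 ?sqr_ge0.
  by nra.
have -> : s ^+ 2 = (x 0 p * x 0 p + u 0 p * u 0 p) ^+ 2 by rewrite /s !expr2.
have -> : s = \sum_k (x 0 p * x 0 k + u 0 p * u 0 k) ^+ 2.
  transitivity (x 0 p ^+ 2 * (\sum_k x 0 k ^+ 2) + u 0 p ^+ 2 * (\sum_k u 0 k ^+ 2)
    + 2 * x 0 p * u 0 p * \sum_k x 0 k * u^T k 0).
    by rewrite x1 u1 xu /s; ring.
  rewrite !mulr_sumr -!big_split; apply: eq_bigr => k _ /=; rewrite mxE; ring.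
rewrite (bigD1 p) //= lerDl; apply: sumr_ge0 => k _; exact: sqr_ge0.
Qed.

Lemma trace_specf1 (R : rcfType) n (U : 'M[R]_n) (a : 'rV[R]_n) f : U *m U^T = 1%:M ->
  \tr (specf U a f) = \sum_p f (a 0 p).
Proof.
move=> UU; rewrite /specf mxtrace_mulC mulmxA UU mul1mx mxtrace_diag.
by apply: eq_bigr => p _; rewrite mxE.
Qed.

Lemma specf_kernel (R : rcfType) n (U : 'M[R]_n) (a u : 'rV[R]_n) f p : U *m U^T = 1%:M ->
  u *m specf U a f = 0 -> (u *m U^T) 0 p * f (a 0 p) = 0.
Proof.
move=> UU uA; have : u *m specf U a f *m U^T = 0 by rewrite uA mul0mx.
rewrite /specf !mulmxA -(mulmxA _ U) UU mulmx1 => /matrixP/(_ 0 p).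
by rewrite mul_mx_diag !mxE.
Qed.

(** The tangent of [exp] at the mean [m] lies below [exp]. The squared coordinates of [x] in the
    eigenbasis sum to [1], so the linear term averages to zero. *)
Lemma exp_jensen n (U : 'M[R]_n) (a x : 'rV[R]_n) : U *m U^T = 1%:M ->
  sqn x = 1 -> exp (quad (specf U a id) x) <= quad (specf U a exp) x.
Proof.
move=> UU x1; set m := quad _ _.
have w1 : \sum_p (x *m U^T) 0 p ^+ 2 = 1 by rewrite -sqnE sqn_orth.
have -> : exp m = \sum_p exp m * (1 + (a 0 p - m)) * (x *m U^T) 0 p ^+ 2.
  transitivity (exp m * ((1 - m) * \sum_p (x *m U^T) 0 p ^+ 2 + m)).
    by rewrite w1; ring.
  rewrite {3}/m quad_specf mulr_sumr -big_split mulr_sumr /=.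
  by apply: eq_bigr => p _; ring.
rewrite quad_specf; apply: ler_sum => p _; apply: ler_wpM2r; first exact: sqr_ge0.
have -> : exp (a 0 p) = exp m * exp (a 0 p - m) by rewrite -exp_addr addrC subrK.
by rewrite ler_wpM2l ?exp_ge1Dx // ltW ?exp_gt0.
Qed.

(** * Trace of the exponential of a matrix with a unit kernel vector *)

Section KernelVector.
Variables (n : nat) (U : 'M[R]_n) (a u : 'rV[R]_n).
Hypotheses (UU : U *m U^T = 1%:M) (u1 : sqn u = 1) (uA : u *m specf U a id = 0).

Lemma quad_exp_kernel : quad (specf U a exp) u = 1.
Proof.
rewrite quad_specf -u1 -(sqn_orth u UU) sqnE; apply: eq_bigr => p _.
have /eqP := specf_kernel p UU uA; rewrite mulf_eq0 => /orP[]/eqP ->.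
  by rewrite expr0n mulr0.
by rewrite expR0 mul1r.
Qed.

Lemma trace_exp_ge1 : 1 <= \tr (specf U a exp).
Proof.
rewrite -[leLHS]quad_exp_kernel quad_specf trace_specf1 //; apply: ler_sum => p _.
have up : (u *m U^T) 0 p ^+ 2 <= 1.
  rewrite -[leRHS]u1 -(sqn_orth u UU) sqnE (bigD1 p) //= lerDl.
  by apply: sumr_ge0 => q _; exact: sqr_ge0.
by rewrite -[leRHS]mulr1 ler_wpM2l // ltW ?exp_gt0.
Qed.

(** After Jensen at [x], Bessel bounds by [1] the total weight that [x] and [u] put on each
    eigenvector. The forms at [x] and [u] thus sum to at most the trace, and the form at [u] is
    [1]. *)
Lemma exp_quad_le_trace x : sqn x = 1 -> x *m u^T = 0 ->
  exp (quad (specf U a id) x) <= \tr (specf U a exp) - 1.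
Proof.
move=> x1 xu; apply: le_trans (exp_jensen a UU x1) _.
rewrite lerBrDr -[X in _ + X]quad_exp_kernel !quad_specf trace_specf1 // -big_split.
apply: ler_sum => p _; rewrite /= -mulrDr -[leRHS]mulr1.
apply: ler_wpM2l; first by rewrite ltW ?exp_gt0.
apply: bessel_entry; rewrite ?sqn_orth //.
by rewrite trmx_mul trmxK mulmxA -(mulmxA x) (mulmx1C UU) mulmx1.
Qed.
End KernelVector.

(** * The multiplicative weights potential *)

Definition is_expmx n (A E : 'M[R]_n) := exists U a,
  [/\ U *m U^T = 1%:M, A = specf U a id & E = specf U a exp].

(** The potential tr E - 1 starts at [n - 1] and each round multiplies it by at most
    [1 - delta <= exp (- delta)]. The final potential dominates the exponential of the form at every
    unit [x] orthogonal to [u]. *)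
Theorem matrix_multiplicative_weights n T (u : 'rV[R]_n) (N E : nat -> 'M[R]_n)
    (eps omega kappa : R) :
  0 <= eps -> 0 <= omega -> 3 / 2 * (eps * omega) <= 1 -> sqn u = 1 ->
  (forall t, (t < T)%N ->
    [/\ u *m N t = 0, psdm (N t) & psdm (omega%:M - N t)]) ->
  (forall t, (t <= T)%N -> is_expmx (- eps *: \sum_(i < t) N i) (E t)) ->
  (forall t, (t < T)%N -> kappa * (\tr (E t) - 1) <= \tr (N t *m E t)) ->
  forall x, sqn x = 1 -> x *m u^T = 0 ->
  exp (- eps * quad (\sum_(i < T) N i) x) <=
    (n%:R - 1) * exp (- ((1 - 3 / 2 * (eps * omega)) * eps * kappa)) ^+ T.
Proof.
move=> eps0 omega0 small u1 HN HE Hk x x1 xu.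
set delta := _ * kappa.
have uS t : (t <= T)%N -> u *m (- eps *: \sum_(i < t) N i) = 0.
  move=> tT; rewrite -scalemxAr mulmx_sumr big1 ?scaler0 // => i _.
  by have [] := HN i (leq_trans (ltn_ord i) tT).
have phi t : (t <= T)%N -> \tr (E t) - 1 <= (n%:R - 1) * exp (- delta) ^+ t.
  elim: t => [|t IHt] tT.
    have [U [a [UU defA ->]]] := HE 0 tT.
    (* The exponent at [t = 0] is the zero matrix: its eigenvalues, read as forms at the rows of
       [U], vanish, and the trace is [n]. *)
    rewrite trace_specf1 // expr0 mulr1 lerD2r.
    rewrite (eq_bigr (fun=> 1)) ?sumr_const ?card_ord // => p _.
    by rewrite -(quad_row_specf a id p UU) -defA big_ord0 scaler0 /quad
      mulmx0 mul0mx mxE expR0.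
  have {}IHt := IHt (ltnW tT).
  have [U [a [UU defA defE]]] := HE t (ltnW tT).
  have [W [c [WW defC defF]]] := HE t.+1 tT.
  have [uN N0 Nomega] := HN t tT.
  have defB : specf U a id - specf W c id = eps *: N t.
    by rewrite -defA -defC big_ord_recr /= scalerDr !scaleNr opprD !opprK addKr.
  have phi0 : 0 <= \tr (E t) - 1.
    rewrite subr_ge0 defE (@trace_exp_ge1 _ _ _ u) // -defA uS //.
    exact: ltnW.
  have step : \tr (E t.+1) <=
      \tr (E t) - (1 - 3 / 2 * (eps * omega)) * (eps * \tr (N t *m E t)).
    have := @trace_exp_sub_le _ U W a c (eps * omega) UU WW.
    rewrite /= defB -defE -defF -scalemxAl mxtraceZ; apply.
    - by move=> y; rewrite quadZ mulr_ge0.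
    - by move=> y; rewrite -scale_scalar_mx -scalerBr quadZ mulr_ge0.
    - exact: mulr_ge0.
  have {}step : \tr (E t.+1) - 1 <= (\tr (E t) - 1) * (1 - delta).
    have := Hk t tT; rewrite -subr_ge0 /delta => trN.
    (* By [small] the coefficient is nonnegative, so the lower bound on the trace of [N t *m E t]
       may be inserted. *)
    have : 0 <= (1 - 3 / 2 * (eps * omega)) * eps *
        (\tr (N t *m E t) - kappa * (\tr (E t) - 1)).
      by rewrite mulr_ge0 // mulr_ge0 // subr_ge0.
    lra.
  apply: le_trans step _; rewrite exprSr mulrA.
  apply: le_trans (_ : (\tr (E t) - 1) * exp (- delta) <= _).
    by rewrite ler_wpM2l // exp_ge1Dx.
  by rewrite ler_wpM2r // ltW // exp_gt0.
have [U [a [UU defA defE]]] := HE T (leqnn T).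
rewrite -quadZ; apply: le_trans (phi T (leqnn T)).
by rewrite defA defE (@exp_quad_le_trace _ _ _ u) // -defA uS.
Qed.

Arguments matrix_multiplicative_weights : clear scopes.

(** * From functions on nat to matrices *)

Definition toM n (A : Mat) : 'M[R]_n := \matrix_(i, j) A i j.

Lemma fsumE k f : fsum k f = \sum_(i < k) f i.
Proof.
by elim: k => [|k IHk]; rewrite ?big_ord0 // big_ord_recr /= -IHk RplusE.
Qed.

(** Rounds count from [1] and ordinals from [0], hence the successor. *)
Lemma fsum_rangeE k f : fsum_range 1 k f = \sum_(i < k) f i.+1.
Proof. by rewrite /fsum_range PeanoNat.Nat.sub_succ PeanoNat.Nat.sub_0_r fsumE. Qed.

Lemma kronE i j : kron i j = (i == j)%:R.
Proof.
rewrite /kron; case: PeanoNat.Nat.eqb_spec => [->|/eqP/negPf ->] //.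
by rewrite eqxx.
Qed.

Lemma mdotE n A B : mdot n A B = \tr ((toM n A)^T *m toM n B).
Proof.
rewrite /mdot fsumE /mxtrace; under eq_bigr do rewrite fsumE.
rewrite exchange_big; apply: eq_bigr => j _; rewrite mxE.
by apply: eq_bigr => i _; rewrite !mxE.
Qed.

Lemma qformE n A x :
  fsum n (fun i => fsum n (fun j => (x i * A i j * x j)%R)) =
  quad (toM n A) (\row_i x i).
Proof.
rewrite fsumE /quad mxE; under eq_bigr do rewrite fsumE.
rewrite exchange_big; apply: eq_bigr => j _; rewrite !mxE mulr_suml.
by apply: eq_bigr => i _; rewrite !mxE.
Qed.

Lemma psdP n A : psd n A <-> psdm (toM n A).
Proof.
split=> [A0 x|A0 x]; last by rewrite qformE; exact/RleP/A0.
have /RleP := A0 (fun k => if insub k is Some i then x 0 i else 0).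
rewrite qformE; congr (0 <= quad _ _); apply/rowP => i.
by rewrite mxE insubT //= => ltin; congr (x _ _); apply: val_inj.
Qed.

(** * The exponential series in an eigenbasis *)

Lemma toM_mpow n A (U : 'M[R]_n) a k : U *m U^T = 1%:M ->
  toM n A = specf U a id -> toM n (mpow n A k) = specf U a (fun x => x ^+ k).
Proof.
move=> UU defA; elim: k => [|k IHk].
  transitivity (1%:M : 'M[R]_n).
    by apply/matrixP => i j; rewrite !mxE /= /mid kronE.
  by rewrite -(specf1 a UU); apply: eq_specf.
transitivity (toM n (mpow n A k) *m toM n A).
  apply/matrixP => i j; rewrite !mxE /= /mmul fsumE.
  by apply: eq_bigr => p _; rewrite !mxE.
by rewrite IHk defA specfM //; apply: eq_specf => x; rewrite exprSr.
Qed.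

Lemma specf_entry n (U : 'M[R]_n) a f i j :
  specf U a f i j = \sum_p U p i * U p j * f (a 0 p).
Proof.
by rewrite /specf mxE; apply: eq_bigr => p _; rewrite mul_mx_diag !mxE; ring.
Qed.

Lemma Un_cv_sum (I : Type) (r : seq I) (u : I -> nat -> R) (l : I -> R) :
  (forall p, Un_cv (u p) (l p)) ->
  Un_cv (fun K => \sum_(p <- r) u p K) (\sum_(p <- r) l p).
Proof.
move=> ul; elim: r => [|p r IHr].
  move=> e e0; exists 0%N => K _; rewrite !big_nil.
  by rewrite Rfunctions.Rdist_eq.
rewrite big_cons => e e0; have [K0 HK] := CV_plus _ _ _ _ (ul p) IHr e e0.
by exists K0 => K KK; rewrite big_cons; exact: HK.
Qed.

Lemma Un_cv_scale (c l : R) (u : nat -> R) :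
  Un_cv u l -> Un_cv (fun K => c * u K) (c * l).
Proof.
move=> ul; apply: CV_mult => // e e0; exists 0%N => K _.
by rewrite Rfunctions.Rdist_eq.
Qed.

(** Each entry of a partial sum is a fixed finite combination of scalar partial sums [E1] at the
    eigenvalues, so convergence follows from the scalar case. *)
Lemma is_mexp_specf n A (U : 'M[R]_n) a E : U *m U^T = 1%:M ->
  toM n A = specf U a id -> toM n E = specf U a exp -> is_mexp n A E.
Proof.
move=> UU defA defE i j /ssrnat.ltP ltin /ssrnat.ltP ltjn.
pose i' := Ordinal ltin; pose j' := Ordinal ltjn.
have -> : E i j = toM n E i' j' by rewrite mxE.
rewrite defE specf_entry.
have cv p := Un_cv_scale (U p i' * U p j') (Exp_prop.E1_cvg (a 0 p)).
move=> e e0; have [K0 HK] := Un_cv_sum (index_enum _) cv e0.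
exists K0 => K KK; have := HK K KK; congr (Rlt (Rfunctions.Rdist _ _) _).
rewrite /mexp_partial sum_f_R0E.
under [RHS]eq_bigr => k _.
  have -> : mpow n A k i j = toM n (mpow n A k) i' j' by rewrite mxE.
  rewrite (toM_mpow _ UU defA) specf_entry RdivE mulr_suml.
  over.
rewrite exchange_big; apply: eq_bigr => p _; rewrite /= /Exp_prop.E1 sum_f_R0E mulr_sumr.
by apply: eq_bigr => k _; rewrite -[RHS]mulrA; congr (_ * _); rewrite RpowE; exact: mulrC.
Qed.

(** [mexp] is picked by [epsilon]. The spectral exponential witnesses that a limit exists, and
    uniqueness of limits identifies the two on indices below [n]. *)
Lemma toM_mexp n A : (toM n A)^T = toM n A ->
  is_expmx (toM n A) (toM n (mexp n A)).
Proof.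
move=> symA; have [U [a [UU defA]]] := real_spectral symA.
have {}defA : toM n A = specf U a id by rewrite /specf map_mx_id.
exists U, a; split => //; set F := specf U a _.
pose E : Mat := fun i j => if (insub i, insub j) is (Some i', Some j') then F i' j' else 0.
have defE : toM n E = F.
  apply/matrixP => i j; rewrite mxE /E !insubT //=.
  by move=> lti ltj; congr (F _ _); apply: val_inj.
have cvE := is_mexp_specf UU defA defE.
rewrite -defE; apply/matrixP => i j; rewrite !mxE.
have cvX : is_mexp n A (mexp n A).
  by apply: (epsilon_spec (inhabits mzero)); exists E.
apply: UL_sequence (cvX i j _ _) (cvE i j _ _); exact/ssrnat.ltP/ltn_ord.
Qed.

(** * The normalised Laplacians *)

Section Graph.
Variables (n : nat) (adj : nat -> nat -> bool).
Hypothesis n_gt0 : (0 < n)%N.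
Hypothesis adj_sym : forall i j : 'I_n, adj i j = adj j i.
Hypothesis deg_gt0 : forall i : 'I_n, 0 < deg n adj i.
Local Notation d := (deg n adj).
Local Notation tm := (twom n adj).
Local Notation q i := (R_sqrt.sqrt (d i)).

Lemma degE i : d i = \sum_(j < n) adjm adj i j.
Proof. exact: fsumE. Qed.

Lemma twomE : tm = \sum_(i < n) d i.
Proof. exact: fsumE. Qed.

Lemma twom_gt0 : 0 < tm.
Proof.
rewrite twomE (bigD1 (Ordinal n_gt0)) //=; apply: ltr_wpDr (deg_gt0 (Ordinal n_gt0)).
by apply: sumr_ge0 => i _; exact/ltW/deg_gt0.
Qed.

Lemma sqrt_deg_gt0 (i : 'I_n) : 0 < q i.
Proof. exact/RltP/R_sqrt.sqrt_lt_R0/RltP. Qed.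

Lemma sqrt_deg_sqr (i : 'I_n) : q i * q i = d i.
Proof. exact/R_sqrt.sqrt_sqrt/RleP/ltW. Qed.

Lemma mu_sum : \sum_(i < n) mu n adj i = 1.
Proof.
rewrite /mu; under eq_bigr do rewrite RdivE.
by rewrite -mulr_suml -twomE divff // gt_eqF ?twom_gt0.
Qed.

Definition uvec : 'rV[R]_n := \row_i (q i / R_sqrt.sqrt tm).

Lemma sqrt_twom_gt0 : 0 < R_sqrt.sqrt tm.
Proof. exact/RltP/R_sqrt.sqrt_lt_R0/RltP/twom_gt0. Qed.

Lemma sqrt_twom_sqr : R_sqrt.sqrt tm * R_sqrt.sqrt tm = tm.
Proof. exact/R_sqrt.sqrt_sqrt/RleP/ltW/twom_gt0. Qed.

Lemma uvec_mul (i j : 'I_n) : uvec 0 i * uvec 0 j = tm^-1 * (q i * q j).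
Proof.
rewrite !mxE -[in RHS]sqrt_twom_sqr; field.
by rewrite gt_eqF ?sqrt_twom_gt0.
Qed.

Lemma sqn_uvec : sqn uvec = 1.
Proof.
rewrite sqnE -mu_sum; apply: eq_bigr => i _.
by rewrite expr2 uvec_mul sqrt_deg_sqr /mu RdivE mulrC.
Qed.

Lemma toM_Ihat : toM n (Ihat n adj) = 1%:M - uvec^T *m uvec.
Proof.
apply/matrixP => i j; rewrite !mxE big_ord1 [uvec^T _ _]mxE uvec_mul.
by rewrite /Ihat kronE.
Qed.

Lemma toM_dhalf A (i j : 'I_n) :
  toM n (dhalf_conj n adj A) i j = A i j / (q i * q j).
Proof.
rewrite mxE /dhalf_conj invfM mulrA [in RHS](mulrC (A i j)).
by [].
Qed.

Lemma toM_dhalf_lapK :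
  toM n (dhalf_conj n adj (lapK n adj)) = tm^-1 *: (1%:M - uvec^T *m uvec).
Proof.
apply/matrixP => i j; rewrite toM_dhalf -toM_Ihat !mxE.
rewrite /lapK /Ihat /mu !kronE !(RmultE, RminusE, RdivE, RinvE).
have t0 := twom_gt0; have [->|ij] := eqVneq i j.
  have := deg_gt0 j; rewrite eqxx sqrt_deg_sqr => dj0.
  by field; rewrite !gt_eqF.
rewrite val_eqE (negPf ij).
(* Degrees become squares of generalised positive roots, which leaves a rational identity for
   [field]. *)
move: (sqrt_deg_gt0 i) (sqrt_deg_gt0 j) (esym (sqrt_deg_sqr i)) (esym (sqrt_deg_sqr j)).
move: (q i) (q j) => a b a0 b0 -> ->.
by rewrite mulr0n; field; rewrite !gt_eqF.
Qed.

Lemma toM_dhalf_sym (A : Mat) : (forall i j : 'I_n, A i j = A j i) ->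
  (toM n (dhalf_conj n adj A))^T = toM n (dhalf_conj n adj A).
Proof.
by move=> symA; apply/matrixP => i j; rewrite mxE !toM_dhalf symA (mulrC (q i)).
Qed.

(** The factor [D^{-1/2}] turns [u] into a multiple of the all-ones vector, so only column sums
    matter. *)
Lemma uvec_dhalf (A : Mat) : (forall j : 'I_n, \sum_(i < n) A i j = 0) ->
  uvec *m toM n (dhalf_conj n adj A) = 0.
Proof.
move=> colA; apply/rowP => j; rewrite !mxE.
transitivity ((\sum_(i < n) A i j) * ((R_sqrt.sqrt tm)^-1 / q j)).
  rewrite mulr_suml; apply: eq_bigr => i _; rewrite toM_dhalf mxE; field.
  by rewrite !gt_eqF ?sqrt_deg_gt0 ?sqrt_twom_gt0.
by rewrite colA mul0r.
Qed.

Lemma quad_dhalf A (x : 'rV[R]_n) :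
  quad (toM n (dhalf_conj n adj A)) x = quad (toM n A) (\row_i (x 0 i / q i)).
Proof.
rewrite /quad !mxE; apply: eq_bigr => j _; rewrite !mxE !mulr_suml.
apply: eq_bigr => i _; rewrite toM_dhalf !mxE; field.
by rewrite !gt_eqF ?sqrt_deg_gt0.
Qed.

Lemma MabE alpha beta (k l : 'I_n) : Mab n adj alpha beta k l =
  tm^-1 * lap n adj k l + \sum_(i < n) beta i * Rmat n adj i k l
  - alpha * lapK n adj k l.
Proof. by rewrite /Mab fsumE. Qed.

Lemma kron_sum (F : nat -> R) (j : 'I_n) : \sum_(i < n) kron i j * F i = F j.
Proof.
rewrite (bigD1 j) //= kronE eqxx mulr1n mul1r big1 ?addr0 // => i.
by rewrite kronE val_eqE => /negPf ->; rewrite mul0r.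
Qed.

Lemma lap_col_sum (j : 'I_n) : \sum_(i < n) lap n adj i j = 0.
Proof.
rewrite /lap; under eq_bigr => i _.
  rewrite RminusE RmultE /adjm adj_sym -/(adjm adj j i).
  over.
by rewrite sumrB -degE (kron_sum (deg n adj)) subrr.
Qed.

Lemma lapK_col_sum (j : 'I_n) : \sum_(i < n) lapK n adj i j = 0.
Proof.
rewrite /lapK; under eq_bigr => i _ do rewrite RminusE !RmultE.
by rewrite sumrB (kron_sum (mu n adj)) -mulr_suml mu_sum mul1r subrr.
Qed.

Lemma Rmat_col_sum (i j : 'I_n) : \sum_(k < n) Rmat n adj i k j = 0.
Proof.
rewrite /Rmat; under eq_bigr => k _ do rewrite RmultE RminusE -[kron _ _]mulr1.
by rewrite -mulr_suml sumrB (kron_sum (fun=> 1)) mu_sum subrr mul0r.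
Qed.

Lemma Mab_col_sum alpha beta (j : 'I_n) :
  \sum_(k < n) Mab n adj alpha beta k j = 0.
Proof.
under eq_bigr do rewrite MabE.
rewrite sumrB big_split /= -!mulr_sumr lap_col_sum lapK_col_sum exchange_big /=.
rewrite big1 ?mulr0 ?addr0 ?subrr // => i _.
by rewrite -mulr_sumr Rmat_col_sum mulr0.
Qed.

Lemma kron_mul_sym (F : nat -> R) (k l : 'I_n) : kron k l * F k = kron l k * F l.
Proof. by rewrite !kronE eq_sym; case: eqP => [->|]; rewrite ?mul0r. Qed.

Lemma lapK_sym (k l : 'I_n) : lapK n adj k l = lapK n adj l k.
Proof.
rewrite /lapK !RminusE !RmultE kron_mul_sym; congr (_ - _); exact: mulrC.
Qed.

Lemma Mab_sym alpha beta (k l : 'I_n) :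
  Mab n adj alpha beta k l = Mab n adj alpha beta l k.
Proof.
rewrite !MabE lapK_sym; congr (_ * _ + _ - _).
  by rewrite /lap !RminusE !RmultE kron_mul_sym /adjm adj_sym.
by apply: eq_bigr => i _; congr (_ * _); rewrite /Rmat; exact: mulrC.
Qed.
End Graph.

(** * Averaging *)

Lemma toM_mscale n c A : toM n (mscale c A) = c *: toM n A.
Proof. by apply/matrixP => i j; rewrite !mxE. Qed.

Section Projection.
Variables (R : rcfType) (n : nat) (u : 'rV[R]_n).
Hypothesis u1 : sqn u = 1.
Implicit Types (x : 'rV[R]_n) (S : 'M[R]_n).
Let k x := (x *m u^T) 0 0.
Let x0 x := x - k x *: u.

Lemma proj_orth x : x0 x *m u^T = 0.
Proof.
rewrite mulmxBl -scalemxAl [u *m _]mx11_scalar -/(sqn u) u1 scalemx1.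
by rewrite [x *m _]mx11_scalar subrr.
Qed.

(** By symmetry [S] kills [u] on both sides, so only the component of [x] orthogonal to [u]
    contributes. *)
Lemma quad_proj S x : S^T = S -> u *m S = 0 -> quad S x = quad S (x0 x).
Proof.
move=> symS uS; have Su : S *m u^T = 0 by rewrite -symS -trmx_mul uS trmx0.
have trx : (x0 x)^T = x^T - k x *: u^T by rewrite /x0 linearB linearZ.
rewrite /quad trx mulmxBr -scalemxAr -(mulmxA _ S u^T) Su mulmx0 scaler0 subr0.
by rewrite /x0 mulmxBl -scalemxAl uS scaler0 subr0.
Qed.

Lemma quad_projector x : quad (1%:M - u^T *m u) x = sqn (x0 x).
Proof.
rewrite (@quad_proj _ x); last first.
- by rewrite mulmxBr mulmx1 mulmxA [u *m _]mx11_scalar -/(sqn u) u1 mul1mx subrr.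
- by rewrite linearB /= trmx1 trmx_mul trmxK.
by rewrite /quad mulmxBr mulmx1 mulmxA proj_orth mul0mx subr0.
Qed.

Lemma quad_projector_le x : quad (1%:M - u^T *m u) x <= sqn x.
Proof.
rewrite quadB quad_scalar mul1r gerBl /quad mulmxA -mulmxA -[u in u *m x^T]trmxK.
by rewrite -trmx_mul -/(sqn _) sqn_ge0.
Qed.
End Projection.

(** * The rounds: step matrices, potential and lower bound on their sum *)

Section Main.
Variables (n : nat) (adj : nat -> nat -> bool) (gamma : R) (T : nat).
Variables (alpha : nat -> R) (beta : nat -> nat -> R).
Local Notation M t := (Mab n adj (alpha t) (beta t)).
Local Notation K := (lapK n adj).
Local Notation round t := ((1 <= t)%coq_nat /\ (t <= T)%coq_nat).
Local Close Scope ring_scope.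
Local Open Scope R_scope.
Hypothesis Hn : (2 <= n)%coq_nat.
Hypothesis Hg : simple_graph n adj.
Hypothesis Hiso : no_isolated n adj.
Hypothesis Hgamma : 0 < gamma < 1.
Hypothesis HT : INR T >= 6 * 129 * 130 * (ln (INR n) / gamma).
Let P t := mscale (1 / 6) (madd (M t) (mscale gamma K)).
Hypothesis HMX : forall t, round t ->
  mdot n (M t) (Ueps n adj (1 / 130) (msum_range 1 (t - 1)%coq_nat P))
    >= 1 / 64 * gamma.
Hypothesis Hlow : forall t, round t -> loewner_le n (mscale (- gamma) K) (M t).
Hypothesis Hup : forall t, round t -> loewner_le n (M t) (mscale 3 K).
Local Close Scope R_scope.
Local Open Scope ring_scope.

Let n_gt0 : (0 < n)%N.
Proof. by apply: ltnW; apply/ssrnat.leP. Qed.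

Let adj_sym (i j : 'I_n) : adj i j = adj j i.
Proof. by case: Hg => sym _; apply: sym; apply/ssrnat.ltP. Qed.

Let deg_gt0 (i : 'I_n) : 0 < deg n adj i.
Proof.
have [j [/ssrnat.ltP jn ij]] := Hiso (ssrnat.ltP (ltn_ord i)).
rewrite degE (bigD1 (Ordinal jn)) //= {1}/adjm ij; apply: ltr_wpDr; last exact: ltr01.
by apply: sumr_ge0 => k _; rewrite /adjm; case: ifP => _; rewrite ?ler01.
Qed.

Let gamma01 : 0 < gamma < 1.
Proof. by case: Hgamma => /RltP -> /RltP ->. Qed.

Let T_ge : 6 * 129 * 130 * (Rpower.ln n%:R / gamma) <= T%:R.
Proof. by move: HT => /Rge_le/RleP; rewrite !RealsE. Qed.

Let round_lt t : (t < T)%N -> round t.+1.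
Proof. by move=> tT; split; [exact/ssrnat.leP | exact/ssrnat.leP]. Qed.

Local Notation tm := (twom n adj).
Local Notation u := (uvec n adj).
Local Notation Dh A := (toM n (dhalf_conj n adj A)).

Let tm0 : 0 < tm := twom_gt0 n_gt0 deg_gt0.
Let u1 : sqn u = 1 := sqn_uvec n_gt0 deg_gt0.

Lemma Dh_madd A B : Dh (madd A B) = Dh A + Dh B.
Proof. by apply/matrixP => i j; rewrite toM_dhalf [RHS]mxE !toM_dhalf -mulrDl. Qed.

Lemma Dh_mscale c A : Dh (mscale c A) = c *: Dh A.
Proof. by apply/matrixP => i j; rewrite toM_dhalf [RHS]mxE toM_dhalf mulrA. Qed.

Lemma Dh_msum s F : Dh (msum_range 1 s F) = \sum_(i < s) Dh (F i.+1).
Proof.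
apply/matrixP => i j; rewrite toM_dhalf summxE /msum_range fsum_rangeE mulr_suml.
by apply: eq_bigr => t _; rewrite toM_dhalf.
Qed.

(** Conjugation by [D^{-1/2}] is self-adjoint for the matrix scalar product, so it passes from the
    exponential to [A]. *)
Lemma mdot_dhalf A c E :
  mdot n A (mscale c (dhalf_conj n adj E)) = c * \tr ((Dh A)^T *m toM n E).
Proof.
rewrite /mdot fsumE /mxtrace; under eq_bigr do rewrite fsumE.
rewrite exchange_big mulr_sumr; apply: eq_bigr => j _; rewrite mxE mulr_sumr.
apply: eq_bigr => i _; rewrite mxE toM_dhalf mxE /mscale !RmultE.
have -> : dhalf_conj n adj E i j = Dh E i j by rewrite mxE.
rewrite toM_dhalf; ring.
Qed.

Lemma loewner_Dh A B x : loewner_le n A B -> quad (Dh A) x <= quad (Dh B) x.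
Proof.
move=> /psdP/(_ (\row_i (x 0 i / R_sqrt.sqrt (deg n adj i)))).
have m1 : IZR (-1) = -1 :> R by [].
by rewrite -quad_dhalf // Dh_madd Dh_mscale quadD quadZ m1 mulN1r subr_ge0.
Qed.

(** The conjugate of the step matrix of round [t + 1], with the factor [2m] of the exponent of
    [Ueps] absorbed. *)
Let N t : 'M[R]_n := (tm / 6) *: (Dh (M t.+1) + gamma *: Dh K).
Let eps := Rdiv (IZR 1) (IZR 130).
Let A t := mscale (Ropp (Rmult tm eps)) (dhalf_conj n adj (msum_range 1 t P)).
Let E t := mexp n (A t).

Let epsE : eps = 1 / 130.
Proof. by rewrite /eps !RealsE. Qed.

Let sixthE : Rdiv (IZR 1) (IZR 6) = 1 / 6 :> R.
Proof. by rewrite !RealsE. Qed.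

Lemma toM_A t : toM n (A t) = (- (1 / 130)) *: \sum_(i < t) N i.
Proof.
rewrite toM_mscale Dh_msum !scaler_sumr; apply: eq_bigr => i _.
rewrite Dh_mscale Dh_madd Dh_mscale /N !scalerA; congr (_ *: _).
by rewrite epsE sixthE RoppE RmultE; field.
Qed.

Lemma N_sym t : (N t)^T = N t.
Proof.
rewrite /N linearZ linearD linearZ /= !toM_dhalf_sym //.
  exact: lapK_sym.
exact: Mab_sym.
Qed.

Lemma u_N t : u *m N t = 0.
Proof.
have uM : u *m Dh (M t.+1) = 0.
  by apply: uvec_dhalf => // j; exact: Mab_col_sum.
have uK : u *m Dh K = 0 by apply: uvec_dhalf => // j; exact: lapK_col_sum.
by rewrite -scalemxAr mulmxDr -scalemxAr uM uK scaler0 addr0 scaler0.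
Qed.

Lemma quad_DhK x : tm * quad (Dh K) x = quad (1%:M - u^T *m u) x.
Proof. by rewrite toM_dhalf_lapK // quadZ mulrA divff ?mul1r ?gt_eqF. Qed.

Lemma quad_N t x : quad (N t) x = tm / 6 * quad (Dh (M t.+1)) x
  + gamma / 6 * quad (1%:M - u^T *m u) x.
Proof. by rewrite /N quadZ quadD quadZ -quad_DhK; ring. Qed.

(** The lower Loewner bound gives positivity. The upper one gives M + gamma K <= 4 K, and [2m] times
    the conjugate of [K] is a projector, whence 4/6 = 2/3. *)
Lemma N_bounds t : (t < T)%N -> psdm (N t) /\ psdm ((2 / 3)%:M - N t).
Proof.
move=> tT; have /andP[g0 g1] := gamma01; split=> x.
  have := loewner_Dh x (Hlow (round_lt tT)).
  rewrite Dh_mscale quadZ quad_N -quad_DhK RoppE => low.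
  suff : 0 <= tm / 6 * (quad (Dh (M t.+1)) x + gamma * quad (Dh K) x) by lra.
  by apply: mulr_ge0; [rewrite divr_ge0 ?ltW | lra].
have := loewner_Dh x (Hup (round_lt tT)).
rewrite Dh_mscale quadZ quadB quad_scalar quad_N => up.
have three : IZR 3 = 3 :> R by rewrite !RealsE.
have : 0 <= tm / 6 * (3 * quad (Dh K) x - quad (Dh (M t.+1)) x).
  by apply: mulr_ge0; [rewrite divr_ge0 ?ltW | rewrite subr_ge0 -three].
have := quad_projector_le u x; have := quad_DhK x.
have : 0 <= quad (1%:M - u^T *m u) x by rewrite quad_projector // sqn_ge0.
nra.
Qed.

Lemma E_expmx t : is_expmx (- (1 / 130) *: \sum_(i < t) N i) (toM n (E t)).
Proof.
rewrite -toM_A; apply: toM_mexp; rewrite toM_A linearZ linear_sum /=.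
by congr (_ *: _); apply: eq_bigr => i _; exact: N_sym.
Qed.

Lemma u_sumN t : u *m (- (1 / 130) *: \sum_(i < t) N i) = 0.
Proof. by rewrite -scalemxAr mulmx_sumr big1 ?scaler0 // => i _; rewrite u_N. Qed.

(** The exponent kills [u], so its exponential fixes the form at [u] to [1]. *)
Lemma trace_proj_E t :
  \tr ((1%:M - u^T *m u) *m toM n (E t)) = \tr (toM n (E t)) - 1.
Proof.
rewrite mulmxBl mul1mx linearB /=.
congr (_ - _); rewrite -mulmxA mxtrace_mulC [_ *m u^T]mx11_scalar.
have [U [a [UU defA ->]]] := E_expmx t.
rewrite -/(quad _ u) (quad_exp_kernel UU u1) ?mxtrace_scalar ?mulr1n //.
by rewrite -defA u_sumN.
Qed.

Lemma mdot_Ihat_E t : mdot n (Ihat n adj) (E t) = \tr (toM n (E t)) - 1.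
Proof.
by rewrite mdotE toM_Ihat // linearB /= trmx1 trmx_mul trmxK trace_proj_E.
Qed.

(* 65/384 = (1 + 1/64) / 6. *)
Lemma trace_N_E t : (t < T)%N ->
  65 / 384 * gamma * (\tr (toM n (E t)) - 1) <= \tr (N t *m toM n (E t)).
Proof.
move=> tT; have c64 : Rmult (Rdiv (IZR 1) (IZR 64)) gamma = gamma / 64.
  by rewrite !RealsE mul1r mulrC.
have /Rge_le/RleP := HMX (round_lt tT).
rewrite c64 /Ueps [(t.+1 - 1)%coq_nat]PeanoNat.Nat.sub_succ PeanoNat.Nat.sub_0_r.
rewrite -/(A t) -/(E t) mdot_Ihat_E mdot_dhalf.
rewrite toM_dhalf_sym; last exact: Mab_sym.
set Phi := \tr _ - 1; set m := \tr _ => hm.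
(* The [K] part contributes exactly [gamma / 6 * Phi], while [hm] says that [tm * m / Phi] is at
   least [gamma / 64]. *)
have -> : \tr (N t *m toM n (E t)) = tm / 6 * m + gamma / 6 * Phi.
  rewrite /N -scalemxAl mulmxDl mxtraceZ mxtraceD mulrDr; congr (_ + _).
  rewrite -scalemxAl mxtraceZ toM_dhalf_lapK // -scalemxAl mxtraceZ.
  by rewrite trace_proj_E -/Phi; field; rewrite gt_eqF.
have [U [a [UU defA defE]]] := E_expmx t.
have Phi0 : 0 <= Phi.
  by rewrite subr_ge0 defE; apply: (trace_exp_ge1 UU u1); rewrite -defA u_sumN.
(* If Phi = 0, the junk value 0^-1 = 0 makes M . X^(t) vanish, against HMX. *)
have Phin0 : Phi != 0.
  apply: contraTneq hm => ->; rewrite !RealsE invr0 mulr0 mul0r -ltNge.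
  by case/andP: gamma01; lra.
have Phigt0 : 0 < Phi by rewrite lt_def Phin0.
move: hm; rewrite RdivE mulrAC ler_pdivlMr //; lra.
Qed.

Lemma ln_n_gt0 : 0 < Rpower.ln n%:R.
Proof.
rewrite -[0]ln_1; apply/RltP/Rpower.ln_increasing; first exact/RltP/ltr01.
by apply/RltP; rewrite ltr1n; apply/ssrnat.leP.
Qed.

Lemma T_gt0 : 0 < T%:R :> R.
Proof.
have /andP[g0 _] := gamma01; apply: lt_le_trans T_ge.
by apply: mulr_gt0; [lra | rewrite divr_gt0 ?ln_n_gt0].
Qed.

Lemma quad_sumN_ge_unit x : sqn x = 1 -> x *m u^T = 0 ->
  T%:R * gamma / 6 <= quad (\sum_(i < T) N i) x.
Proof.
move=> x1 xu; have /andP[g0 g1] := gamma01.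
have := @matrix_multiplicative_weights n T u N (fun t => toM n (E t))
  (1 / 130) (2 / 3) (65 / 384 * gamma).
move=> /(_ _ _ _ u1 _ (fun t _ => E_expmx t) trace_N_E x x1 xu) mmw.
have {mmw} : exp (- (1 / 130) * quad (\sum_(i < T) N i) x) <= (n%:R - 1) *
    exp (- ((1 - 3 / 2 * (1 / 130 * (2 / 3))) * (1 / 130) *
    (65 / 384 * gamma))) ^+ T.
  apply: mmw; rewrite ?divr_ge0 //; first by lra.
  by move=> t tT; have [N0 N1] := N_bounds tT; split=> //; exact: u_N.
set delta := _ * (65 / 384 * gamma); rewrite expRX => bound.
(* The factor [n - 1] is replaced by the larger n = exp (ln n). *)
have : exp (- (1 / 130) * quad (\sum_(i < T) N i) x) <
    exp (Rpower.ln n%:R + - delta *+ T).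
  apply: le_lt_trans bound _; rewrite exp_addr ltr_pM2r ?exp_gt0 //.
  rewrite Rpower.exp_ln; first by lra.
  by apply/RltP; rewrite ltr0n.
move=> /RltP/Rpower.exp_lt_inv/RltP; rewrite -mulr_natr.
(* Here [delta] is 129/130 * 1/130 * 65/384 gamma, so Q > (129/768) gamma T - 130 ln n. The bound on
   [T] gives 130 ln n <= gamma T / 774, less than the surplus gamma T / 768 of 129/768 over 1/6. *)
move: T_ge; rewrite -ler_pdivlMl; last by lra.
rewrite ler_pdivrMr // /delta; set L := Rpower.ln _; set Q := quad _ _.
have := T_gt0; nra.
Qed.

Lemma sumN_sym : (\sum_(i < T) N i)^T = \sum_(i < T) N i.
Proof. by rewrite linear_sum; apply: eq_bigr => i _; exact: N_sym. Qed.

(** The unit case extends by homogeneity to the component of [x] orthogonal to [u], the only one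
    that either side sees. *)
Lemma quad_sumN_ge x :
  T%:R * gamma / 6 * quad (1%:M - u^T *m u) x <= quad (\sum_(i < T) N i) x.
Proof.
have uS : u *m (\sum_(i < T) N i) = 0.
  by rewrite mulmx_sumr big1 // => i _; exact: u_N.
rewrite quad_projector // [leRHS](quad_proj x sumN_sym uS).
have := proj_orth u1 x; set y := x - _ => yu.
have [->|y0] := eqVneq y 0; first by rewrite /quad /sqn !mul0mx !mxE mulr0.
have s0 : 0 < sqn y by rewrite lt_def sqn_eq0 y0 sqn_ge0.
pose z := (Num.sqrt (sqn y))^-1 *: y.
have sz : (Num.sqrt (sqn y))^-1 ^+ 2 = (sqn y)^-1 by rewrite exprVn sqr_sqrtr ?ltW.
have z1 : sqn z = 1.
  rewrite /sqn /z linearZ /= -scalemxAl -scalemxAr 2!mxE -/(sqn y) mulrA -expr2 sz.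
  by rewrite mulVf ?gt_eqF.
have zu : z *m u^T = 0 by rewrite -scalemxAl yu scaler0.
have := quad_sumN_ge_unit z1 zu.
rewrite {1}/quad /z linearZ /= -!scalemxAl -scalemxAr 2!mxE mulrA -expr2 sz -/(quad _ y).
rewrite ler_pdivlMl; last exact: s0.
by rewrite [leLHS]mulrC.
Qed.

(** * The averaged pair *)

Let abar := Rmult (Rinv (INR T)) (fsum_range 1 T alpha).
Let bbar i := Rmult (Rinv (INR T)) (fsum_range 1 T (fun t => beta t i)).

(** [Mab] is affine in [alpha] and [beta], and an average is an affine combination. *)
Lemma Mab_avg (k l : 'I_n) :
  \sum_(t < T) M t.+1 k l = T%:R * Mab n adj abar bbar k l.
Proof.
have Tn0 : T%:R != 0 :> R by rewrite gt_eqF ?T_gt0.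
rewrite MabE /abar INRE RmultE RinvE fsum_rangeE mulrBr mulrDr !mulrA divff // mul1r.
under eq_bigr do rewrite MabE.
rewrite sumrB big_split /= sumr_const card_ord -[(_ * _) *+ T]mulr_natl mulrA mulr_suml.
congr (_ + _ - _); rewrite exchange_big mulr_sumr; apply: eq_bigr => i _ /=.
rewrite /bbar INRE RmultE RinvE fsum_rangeE mulrA [X in X * _]mulrA divff // mul1r.
by rewrite mulr_suml.
Qed.

Theorem average_psd : psd n (Mab n adj abar bbar).
Proof.
apply/psdP => x; pose y := \row_i (x 0 i * R_sqrt.sqrt (deg n adj i)).
have -> : quad (toM n (Mab n adj abar bbar)) x = quad (Dh (Mab n adj abar bbar)) y.
  rewrite quad_dhalf //; congr quad; apply/rowP => i.
  by rewrite !mxE mulfK // gt_eqF ?sqrt_deg_gt0.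
have sumN : \sum_(i < T) N i =
    (tm / 6 * T%:R) *: (Dh (Mab n adj abar bbar) + gamma *: Dh K) :> 'M[R]_n.
  rewrite -scaler_sumr big_split /= sumr_const card_ord -[RHS]scalerA; congr (_ *: _).
  rewrite scalerDr -[(gamma *: _) *+ T]scaler_nat; congr (_ + _); apply/matrixP => i j.
  rewrite [RHS]mxE summxE toM_dhalf mulrA -Mab_avg mulr_suml.
  by apply: eq_bigr => t _; rewrite toM_dhalf.
have quadN : quad (\sum_(i < T) N i) y =
    (tm / 6 * T%:R) * (quad (Dh (Mab n adj abar bbar)) y + gamma * quad (Dh K) y).
  rewrite sumN -(quadZ gamma) -quadD; exact: quadZ.
(* The lower bound equals the contribution of [gamma *: Dh K] to the sum, so the two cancel and
   leave a nonnegative multiple of [q]. *)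
have := quad_sumN_ge y; rewrite quadN -quad_DhK.
have := T_gt0; set q := quad (Dh (Mab _ _ _ _)) y => T0 h.
have : 0 <= (tm / 6 * T%:R) * q by lra.
by rewrite pmulr_rge0 // mulr_gt0 // divr_gt0.
Qed.

Lemma average_Vab b :
  (forall t, round t -> Rge (Vab n b (alpha t) (beta t)) (Rmult (Rdiv 3 4) gamma)) ->
  Rge (Vab n b abar bbar) (Rmult (Rdiv 3 4) gamma).
Proof.
move=> HV; set v := Rmult _ gamma in HV *.
apply/Rle_ge/RleP; rewrite -(ler_pM2l T_gt0).
have Tn0 : T%:R != 0 :> R by rewrite gt_eqF ?T_gt0.
have -> : T%:R * Vab n b abar bbar = \sum_(t < T) Vab n b (alpha t.+1) (beta t.+1).
  under [RHS]eq_bigr do rewrite /Vab RminusE RmultE fsumE.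
  rewrite sumrB -mulr_sumr exchange_big /Vab RminusE RmultE fsumE mulrBr.
  rewrite /abar INRE RmultE RinvE fsum_rangeE mulrA divff // mul1r mulrCA.
  congr (_ - _ * _); rewrite mulr_sumr; apply: eq_bigr => i _.
  by rewrite /bbar INRE RmultE RinvE fsum_rangeE mulrA divff // mul1r.
have -> : T%:R * v = \sum_(t < T) v by rewrite sumr_const card_ord mulr_natl.
by apply: ler_sum => t _; apply/RleP/Rge_le/HV/round_lt.
Qed.
End Main.
End MatrixWeights.

Open Scope R_scope.

Theorem theorem2p5
  (n : nat) (adj : nat -> nat -> bool) (b gamma : R) (T : nat)
  (alpha : nat -> R) (beta : nat -> nat -> R)
  (Hn : (2 <= n)%nat)
  (Hg : simple_graph n adj)
  (Hiso : no_isolated n adj)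
  (Hb : 0 < b <= 1 / 2)
  (Hgamma : 0 < gamma < 1)
  (HT : INR T >= 6 * 129 * 130 * (ln (INR n) / gamma))
  (Hbeta : forall t i, (1 <= t <= T)%nat -> (i < n)%nat -> 0 <= beta t i)
  (P := fun t : nat =>
          mscale (1 / 6) (madd (Mab n adj (alpha t) (beta t)) (mscale gamma (lapK n adj))))
  (X := fun t : nat => Ueps n adj (1 / 130) (msum_range 1 (t - 1) P))
  (HV : forall t, (1 <= t <= T)%nat -> Vab n b (alpha t) (beta t) >= 3 / 4 * gamma)
  (HMX : forall t, (1 <= t <= T)%nat ->
           mdot n (Mab n adj (alpha t) (beta t)) (X t) >= 1 / 64 * gamma)
  (Hlow : forall t, (1 <= t <= T)%nat ->
           loewner_le n (mscale (- gamma) (lapK n adj)) (Mab n adj (alpha t) (beta t)))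
  (Hup : forall t, (1 <= t <= T)%nat ->
           loewner_le n (Mab n adj (alpha t) (beta t)) (mscale 3 (lapK n adj))) :
  let abar := / INR T * fsum_range 1 T alpha in
  let bbar := fun i => / INR T * fsum_range 1 T (fun t => beta t i) in
  psd n (Mab n adj abar bbar) /\ Vab n b abar bbar >= 3 / 4 * gamma.
Proof.
intros abar bbar; split.
- exact (MatrixWeights.average_psd Hn Hg Hiso Hgamma HT HMX Hlow Hup).
- exact (MatrixWeights.average_Vab Hn Hgamma HT HV).
Qed.
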